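(* Let $I=(U,R)$ be an approximation space (a non-empty finite set $U$ with an equivalence relation $R$ on $U$), and let $(T,\Delta,\nabla)$ be its rough semiring. Then for all $RS(Y),RS(Z)\in T$, the dual relative pseudocomplement of $RS(Y)$ with respect to $RS(Z)$ is unique; that is, there is exactly one element of $T$ which is a dual relative pseudocomplement of $RS(Y)$ with respect to $RS(Z)$.
   Context: Setting. $U$ is a non-empty finite set, $R$ an equivalence relation on $U$, $[x]_R$ the class of $x$. For $X\subseteq U$ put $R_{-}(X)=\{x\in U: [x]_R\subseteq X\}$, $R^{-}(X)=\{x\in U: [x]_R\cap X\neq\emptyset\}$. The rough set of $X$ is $RS(X)=(R_{-}(X),R^{-}(X))$, and $T=\{RS(X): X\subseteq U\}$. $T$ is ordered componentwise: $RS(X)\le RS(Y)$ iff $R_{-}(X)\subseteq R_{-}(Y)$ and $R^{-}(X)\subseteq R^{-}(Y)$. Operations on subsets of $U$. Let $IW(X)$ be the number of equivalence classes contained in $X$. Praba join: if $IW(X\cup Y)=IW(X)+IW(Y)-IW(X\cap Y)$ then $X\Delta Y=X\cup Y$. If $IW(X\cup Y)>IW(X)+IW(Y)-IW(X\cap Y)$, one identifies an equivalence class newly formed by the union (contained in $X\cup Y$ but in neither $X$ nor $Y$), deletes from $Y$ its elements belonging to that class, calls the result $Y$ again, and repeats until equality holds; then $X\Delta Y$ is the union of $X$ and the final $Y$. Praba meet: $x$ is a pivot element of $X,Y$ if $[x]_R\not\subseteq X\cap Y$, $[x]_R\cap X\ne\emptyset$ and $[x]_R\cap Y\neq\emptyset$;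 the pivot set $P_{X\cap Y}$ consists of one representative pivot element for each such class; $X\nabla Y=\{x\in U:[x]_R\subseteq X\cap Y\}\cup P_{X\cap Y}$. Operations on $T$. $RS(X)\Delta RS(Y)=RS(X\Delta Y)$ and $RS(X)\nabla RS(Y)=RS(X\nabla Y)$; it is known that these are respectively the least upper bound and the greatest lower bound of $RS(X),RS(Y)$ in $T$, and that $(T,\Delta,\nabla)$ is a semiring, called the rough semiring. Definition. For $RS(Y),RS(Z)\in T$, a dual relative pseudocomplement of $RS(Y)$ with respect to $RS(Z)$ is a least element, denoted $RS(Y)\leftarrow RS(Z)$, of the set $\{RS(V)\in T: RS(Z)\Delta RS(V)\ge RS(Y)\}$. *)

(* Defs.v *)
From HB Require Import structures.
From mathcomp Require Import all_boot all_order all_algebra.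

Set Implicit Arguments.
Unset Strict Implicit.
Unset Printing Implicit Defensive.

Import Order.TTheory GRing.Theory.

Section Approximations.
Variables (U : finType) (R : equiv_rel U).
Implicit Types (X Y W C P : {set U}) (x y : U).

Definition eqclass x : {set U} := [set y | R x y].

Definition lower X : {set U} := [set x | eqclass x \subset X].
Definition upper X : {set U} := [set x | eqclass x :&: X != set0].

Definition eqclasses : {set {set U}} := equivalence_partition R [set: U].

Definition IW X : nat := #|[set C in eqclasses | C \subset X]|.

Lemma eqclass_refl x : x \in eqclass x.
Proof. by rewrite inE equiv_refl. Qed.

Lemma eqclass_eq x y : y \in eqclass x -> eqclass y = eqclass x.
Proof.
rewrite inE => Rxy; apply/setP=> z; rewrite !inE.
by apply/idP/idP; apply: equiv_trans => //; rewrite equiv_sym.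
Qed.

Lemma eqclassesP C : reflect (exists x, C = eqclass x) (C \in eqclasses).
Proof.
apply: (iffP imsetP) => [[x _ ->]|[x ->]]; exists x => //.
  by apply/setP=> y; rewrite !inE.
by apply/setP=> y; rewrite !inE.
Qed.

Lemma mem_eqclasses x : eqclass x \in eqclasses.
Proof. by apply/eqclassesP; exists x. Qed.

Lemma mem_upper X x : (x \in upper X) = [exists y in X, R x y].
Proof.
rewrite inE; apply/set0Pn/exists_inP => [[y]|[y Xy Rxy]]; last first.
  by exists y; rewrite !inE Rxy.
by rewrite !inE => /andP[Rxy Xy]; exists y.
Qed.

Lemma eqclass_lower X x y : R x y -> (x \in lower X) = (y \in lower X).
Proof. by move=> Rxy; rewrite !inE (@eqclass_eq x y) // inE. Qed.

Lemma eqclass_upper X x y : R x y -> (x \in upper X) = (y \in upper X).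
Proof. by move=> Rxy; rewrite !inE (@eqclass_eq x y) // inE. Qed.

Lemma upperU X Y : upper (X :|: Y) = upper X :|: upper Y.
Proof.
by apply/setP=> x; rewrite !inE setIUr setU_eq0 negb_and.
Qed.

Lemma lower0 : lower set0 = set0.
Proof.
apply/setP=> x; rewrite !inE subset0; apply/negP=> /eqP e0.
by have := eqclass_refl x; rewrite e0 inE.
Qed.

Lemma upper0 : upper set0 = set0.
Proof. by apply/setP=> x; rewrite !inE setI0 eqxx. Qed.

(* The equivalence classes newly formed by the union. *)
Definition new_class X Y C :=
  [&& C \in eqclasses, C \subset X :|: Y, ~~ (C \subset X) & ~~ (C \subset Y)].

(* [praba_run X Y W]: W is a possible outcome of the procedure defining the
   Praba join of X and Y, which is free to choose the class deleted at each
   step. The subtraction on nat does not truncate, as IW (X :&: Y) <= IW X. *)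
Inductive praba_run X : {set U} -> {set U} -> Prop :=
| PrabaStop Y :
    IW (X :|: Y) = IW X + IW Y - IW (X :&: Y) -> praba_run X Y (X :|: Y)
| PrabaStep Y C W :
    IW X + IW Y - IW (X :&: Y) < IW (X :|: Y) -> new_class X Y C ->
    praba_run X (Y :\: C) W -> praba_run X Y W.

Fixpoint praba_iter n X Y : {set U} :=
  if n isn't n'.+1 then X :|: Y else
  if IW (X :|: Y) == IW X + IW Y - IW (X :&: Y) then X :|: Y else
  if [pick C | new_class X Y C] is Some C then praba_iter n' X (Y :\: C)
  else X :|: Y.

(* A run of the procedure: each step shrinks Y, so this fuel is enough, see
   [praba_joinP]. *)
Definition praba_join X Y : {set U} := praba_iter #|Y|.+1 X Y.

Let F X := [set C in eqclasses | C \subset X].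

Lemma IW_setIU X Y : #|F X :|: F Y| = IW X + IW Y - IW (X :&: Y).
Proof.
rewrite -cardsUI; suff ->: F X :&: F Y = F (X :&: Y) by rewrite addnK.
by apply/setP=> C; rewrite !inE subsetI; case: (C \in _).
Qed.

Lemma IW_newP X Y :
  (IW (X :|: Y) == IW X + IW Y - IW (X :&: Y)) = [forall C, ~~ new_class X Y C].
Proof.
have sF: F X :|: F Y \subset F (X :|: Y).
  apply/subsetP=> C; rewrite !inE => /orP[]/andP[-> sC] /=.
    by rewrite (subset_trans sC) ?subsetUl.
  by rewrite (subset_trans sC) ?subsetUr.
rewrite -IW_setIU eq_sym; have := subset_leqif_card sF => /leqifP.
rewrite /IW -/(F _) (_ : [forall C, _] = (F (X :|: Y) \subset F X :|: F Y)).
  by case: ifP => [_ /eqP->|_ /ltn_eqF]; rewrite ?eqxx.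
apply/forallP/subsetP => [nC C|sC C].
  rewrite !inE => /andP[Cc CU]; have := nC C.
  by rewrite /new_class Cc CU /= negb_and !negbK.
apply/negP=> /and4P[Cc CU nX nY]; have := sC C.
by rewrite !inE Cc CU (negPf nX) (negPf nY) => /(_ isT).
Qed.

Lemma IW_ltU X Y C :
  new_class X Y C -> IW X + IW Y - IW (X :&: Y) < IW (X :|: Y).
Proof.
move=> nC; rewrite ltn_neqAle eq_sym IW_newP; apply/andP; split.
  by apply/forallPn; exists C; rewrite negbK.
rewrite -IW_setIU; apply/subset_leq_card/subsetP=> D.
rewrite !inE => /orP[]/andP[-> sD] /=.
  by rewrite (subset_trans sD) ?subsetUl.
by rewrite (subset_trans sD) ?subsetUr.
Qed.

Lemma new_class_meet X Y C : new_class X Y C -> Y :&: C != set0.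
Proof.
case/and4P=> _ CU /subsetPn[x Cx nXx] _; apply/set0Pn; exists x.
by move/subsetP/(_ x Cx): CU; rewrite !inE Cx (negPf nXx) andbT.
Qed.

Lemma praba_joinP X Y : praba_run X Y (praba_join X Y).
Proof.
rewrite /praba_join; have: #|Y| < #|Y|.+1 by [].
move: {2 3}_.+1 => n; elim: n => // n IHn in Y *; rewrite ltnS /= => leYn.
case: eqP => [|/eqP]; first exact: PrabaStop.
rewrite IW_newP => /forallPn[C]; rewrite negbK => nC.
case: pickP => [D nD|/(_ C)]; last by rewrite nC.
apply: (PrabaStep (IW_ltU nD) nD); apply: IHn.
apply: leq_trans leYn; rewrite -(cardsID D Y) -[ltnLHS]add0n ltn_add2r card_gt0.
exact: new_class_meet nD.
Qed.

Lemma praba_run_lower X Y W :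
  praba_run X Y W -> lower W = lower X :|: lower Y.
Proof.
elim=> {Y W} [Y eqY|Y C W _ nC _ ->].
  apply/setP=> x; rewrite !inE; apply/idP/orP=> [xU|[]sx]; last 2 first.
  - by rewrite (subset_trans sx) ?subsetUl.
  - by rewrite (subset_trans sx) ?subsetUr.
  move/eqP: eqY; rewrite IW_newP => /forallP/(_ (eqclass x)).
  by rewrite /new_class mem_eqclasses xU /= negb_and !negbK => /orP.
congr (_ :|: _); apply/setP=> x; rewrite !inE subsetD.
apply/andb_idr => sxY; apply/pred0P=> y /=; apply/andP=> -[xy Cy].
case/and4P: nC => /eqclassesP[z eC] _ _ /negP[].
by move: Cy; rewrite eC => /eqclass_eq <-; rewrite (eqclass_eq xy).
Qed.

Lemma praba_run_upper X Y W :
  praba_run X Y W -> upper W = upper X :|: upper Y.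
Proof.
elim=> {Y W} [Y _|Y C W _ nC _ ->]; first exact: upperU.
apply/setP=> x; rewrite !in_setU; case: (boolP (x \in upper X)) => //= nXx.
rewrite !mem_upper; apply/exists_inP/exists_inP=> -[y].
  by rewrite inE => /andP[_ Yy] Rxy; exists y.
move=> Yy Rxy; exists y => //; rewrite inE Yy andbT; apply/negP=> Cy.
case/and4P: nC => /eqclassesP[z eC] CU _ /subsetPn[t Ct nYt].
have Xt: t \in X by have /subsetP/(_ t Ct) := CU; rewrite inE (negPf nYt) orbF.
case/negP: nXx; rewrite mem_upper; apply/exists_inP; exists t => //.
move: Cy Ct; rewrite eC !inE => zy; apply: equiv_trans.
by rewrite (equiv_trans Rxy) // equiv_sym.
Qed.

Definition pivots X Y : {set U} :=
  [set x | [&& ~~ (eqclass x \subset X :&: Y), eqclass x :&: X != set0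
             & eqclass x :&: Y != set0]].

(* P consists of pivots, exactly one in each class of pivots. *)
Definition pivot_set X Y P :=
  is_transversal P (equivalence_partition R (pivots X Y)) (pivots X Y).

Definition praba_meet_of P X Y : {set U} := lower (X :&: Y) :|: P.

Definition praba_meet X Y : {set U} :=
  praba_meet_of (transversal (equivalence_partition R (pivots X Y))
                             (pivots X Y)) X Y.

Lemma pivot_partition X Y :
  partition (equivalence_partition R (pivots X Y)) (pivots X Y).
Proof.
apply: equivalence_partitionP => x y z _ _ _.
split=> [|Rxy]; first exact: equiv_refl.
by apply/idP/idP; apply: equiv_trans => //; rewrite equiv_sym.
Qed.

Lemma pivot_setP X Y :
  pivot_set X Y (transversal (equivalence_partition R (pivots X Y))
                             (pivots X Y)).
Proof. exact/transversalP/pivot_partition. Qed.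

Lemma eqclass_pivots X Y x y : R x y -> (x \in pivots X Y) = (y \in pivots X Y).
Proof. by move=> Rxy; rewrite !inE (@eqclass_eq x y) // inE. Qed.

Lemma pivot_setE X Y P x : pivot_set X Y P -> x \in pivots X Y ->
  exists p, P :&: eqclass x = [set p].
Proof.
case/and3P=> _ sP /forall_inP oneP px.
have/oneP/cards1P[p defp] := imset_f
  (fun x => [set y in pivots X Y | R x y]) px.
exists p; rewrite -defp; apply/setP=> y; rewrite !inE.
case: (boolP (y \in P)) => //= Py; rewrite andbC.
by have:= subsetP sP y Py; rewrite inE => ->; rewrite andbT.
Qed.

Lemma praba_meet_lower X Y P : pivot_set X Y P ->
  lower (praba_meet_of P X Y) = lower X :&: lower Y.
Proof.
move=> pP; rewrite /praba_meet_of.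
have lI: lower (X :&: Y) = lower X :&: lower Y.
  by apply/setP=> x; rewrite !inE subsetI.
rewrite -lI; apply/eqP; rewrite eqEsubset; apply/andP; split; last first.
  apply/subsetP=> x lx; rewrite inE; apply/subsetP=> y; rewrite inE => Rxy.
  by rewrite inE -(eqclass_lower (X :&: Y) Rxy) lx.
apply/subsetP=> x; rewrite [in X in X -> _]inE => sx; apply/negPn/negP => nlx.
have sP: eqclass x \subset P.
  apply/subsetP=> y xy; have := subsetP sx y xy; rewrite in_setU.
  by rewrite -(@eqclass_lower (X :&: Y) x) ?(negPf nlx) //; move: xy; rewrite inE.
have Px: x \in P := subsetP sP x (eqclass_refl x).
have/and3P[_ /subsetP/(_ x Px) px _] := pP.
have [p dp] := pivot_setE pP px.
have eCp: eqclass x = [set p] by rewrite -dp (setIidPr sP).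
move: px nlx; rewrite !inE eCp => /and3P[+ Xx Yx]; rewrite sub1set !inE.
have [q] := set0Pn _ Xx; have [r] := set0Pn _ Yx.
by rewrite !inE => /andP[/eqP-> ->] /andP[/eqP-> ->].
Qed.

Lemma praba_meet_upper X Y P : pivot_set X Y P ->
  upper (praba_meet_of P X Y) = upper X :&: upper Y.
Proof.
move=> pP; apply/setP=> x; rewrite mem_upper.
apply/exists_inP/idP=> [[y + Rxy]|].
  rewrite !(eqclass_upper _ Rxy, in_setI) in_setU => /orP[|Py]; last first.
    have/and3P[_ /subsetP/(_ y Py) + _] := pP.
    by rewrite inE !inE => /and3P[_ -> ->].
  rewrite inE subsetI => /andP[sX sY].
  by rewrite !inE !(setIidPl _) // -!card_gt0 andbb;
    apply/card_gt0P; exists y; apply: eqclass_refl.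
rewrite in_setI => /andP[Xx Yx].
have [sx|nsx] := boolP (x \in lower (X :&: Y)).
  by exists x; rewrite ?equiv_refl // inE sx.
have px: x \in pivots X Y by move: Xx Yx nsx; rewrite !inE => -> -> ->.
have [p dp] := pivot_setE pP px.
have: p \in P :&: eqclass x by rewrite dp set11.
by rewrite !inE => /andP[Pp Rxp]; exists p => //; rewrite !inE Pp orbT.
Qed.

(* The set T of rough sets. *)
Record rough := Rough {
  approx : {set U} * {set U};
  _ : [exists X, approx == (lower X, upper X)] }.

HB.instance Definition _ := [isSub for approx].
HB.instance Definition _ := [Finite of rough by <:].

Lemma approx_inj : injective approx.
Proof. exact: val_inj. Qed.

Lemma RS_subproof X : [exists W, (lower X, upper X) == (lower W, upper W)].
Proof. by apply/existsP; exists X. Qed.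

Definition RS X : rough := Rough (RS_subproof X).

Implicit Types (a b c : rough).

Lemma RS_surj a : exists X, RS X == a.
Proof.
by case: a => p pP; have /existsP[X /eqP pX] := pP; exists X; apply/eqP/val_inj.
Qed.

Definition rough_repr a : {set U} := xchoose (RS_surj a).

Lemma rough_reprK a : RS (rough_repr a) = a.
Proof. exact/eqP/(xchooseP (RS_surj a)). Qed.

End Approximations.

Arguments RS {U} R X.

HB.lock Definition rough_join (U : finType) (R : equiv_rel U) (a b : rough R) :=
  RS R (praba_join R (rough_repr a) (rough_repr b)).
HB.lock Definition rough_meet (U : finType) (R : equiv_rel U) (a b : rough R) :=
  RS R (praba_meet R (rough_repr a) (rough_repr b)).
Arguments rough_join {U R} a b.
Arguments rough_meet {U R} a b.

Section RoughSemiring.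
Variables (U : finType) (R : equiv_rel U).
Implicit Types (X Y W P : {set U}) (a b c : rough R).

Local Notation RS := (RS R).
Local Notation lower := (lower R).
Local Notation upper := (upper R).
Local Notation rough := (rough R).
Local Notation join := (@rough_join U R).
Local Notation meet := (@rough_meet U R).

Definition rough_le a b :=
  ((approx a).1 \subset (approx b).1) && ((approx a).2 \subset (approx b).2).

Lemma approx_repr a :
  approx a = (lower (rough_repr a), upper (rough_repr a)).
Proof. by rewrite -{1}(rough_reprK a). Qed.

Lemma approx_join a b : approx (rough_join a b)
  = ((approx a).1 :|: (approx b).1, (approx a).2 :|: (approx b).2).
Proof.
rewrite unlock /= (praba_run_lower (praba_joinP _ _ _)).
by rewrite (praba_run_upper (praba_joinP _ _ _)) !approx_repr.
Qed.

Lemma approx_meet a b : approx (rough_meet a b)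
  = ((approx a).1 :&: (approx b).1, (approx a).2 :&: (approx b).2).
Proof.
rewrite unlock /= (praba_meet_lower (pivot_setP _ _ _)).
by rewrite (praba_meet_upper (pivot_setP _ _ _)) !approx_repr.
Qed.

(* The operations on T depend neither on the representatives X, Y nor on the
   choices made when computing the Praba join and meet. *)
Lemma rough_join_RS X Y W : praba_run R X Y W -> rough_join (RS X) (RS Y) = RS W.
Proof.
move=> XYW; apply: val_inj; rewrite [LHS]approx_join /=.
by rewrite (praba_run_lower XYW) (praba_run_upper XYW).
Qed.

Lemma rough_meet_RS X Y P : pivot_set R X Y P ->
  rough_meet (RS X) (RS Y) = RS (praba_meet_of R P X Y).
Proof.
move=> pP; apply: val_inj; rewrite [LHS]approx_meet /=.
by rewrite (praba_meet_lower pP) (praba_meet_upper pP).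
Qed.

Fact rough_le_refl : reflexive rough_le.
Proof. by move=> a; rewrite /rough_le !subxx. Qed.

Fact rough_le_anti : antisymmetric rough_le.
Proof.
move=> a b /andP[/andP[ab1 ab2] /andP[ba1 ba2]]; apply: val_inj => /=.
rewrite [LHS]surjective_pairing [RHS]surjective_pairing.
by congr pair; apply/eqP; rewrite eqEsubset ?ab1 ?ab2.
Qed.

Fact rough_le_trans : transitive rough_le.
Proof.
move=> b a c /andP[ab1 ab2] /andP[bc1 bc2].
by rewrite /rough_le (subset_trans ab1) ?(subset_trans ab2).
Qed.

Fact rough_joinA : associative join.
Proof. by move=> a b c; apply: approx_inj; rewrite !approx_join /= !setUA. Qed.

Fact rough_joinC : commutative join.
Proof.
move=> a b; apply: approx_inj; rewrite !approx_join.
by congr pair; rewrite setUC.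
Qed.

Fact rough_join0 : left_id (RS set0) join.
Proof.
move=> a; apply: approx_inj; rewrite !approx_join /=.
by rewrite lower0 upper0 !set0U; case: (approx a).
Qed.

Fact rough_meetA : associative meet.
Proof. by move=> a b c; apply: approx_inj; rewrite !approx_meet /= !setIA. Qed.

Fact rough_meetC : commutative meet.
Proof.
move=> a b; apply: approx_inj; rewrite !approx_meet.
by congr pair; rewrite setIC.
Qed.

Fact rough_meet1 : left_id (RS setT) meet.
Proof.
move=> a; apply: approx_inj; rewrite !approx_meet /=.
have -> : lower setT = setT by apply/setP=> x; rewrite !inE subsetT.
have -> : upper setT = setT.
  apply/setP=> x; rewrite in_setT inE; apply/set0Pn; exists x.
  by rewrite inE eqclass_refl inE.
by rewrite !setTI; case: (approx a).
Qed.

Fact rough_meetUl : left_distributive meet join.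
Proof.
move=> a b c; apply: approx_inj; rewrite !(approx_join, approx_meet) /=.
by rewrite !setIUl.
Qed.

Fact rough_meet0 : left_zero (RS set0) meet.
Proof.
move=> a; apply: approx_inj; rewrite !approx_meet /=.
by rewrite lower0 upper0 !set0I.
Qed.

Fact rough_display : Order.disp_t. Proof. exact: Order.Disp tt tt. Qed.

HB.instance Definition _ := Order.Le_isPOrder.Build rough_display rough
  rough_le_refl rough_le_anti rough_le_trans.

(* The rough semiring: + is the operation Delta, * is the operation Nabla. *)
HB.instance Definition _ := GRing.isNmodule.Build rough
  rough_joinA rough_joinC rough_join0.
HB.instance Definition _ := GRing.Nmodule_isComPzSemiRing.Build rough
  rough_meetA rough_meetC rough_meet1 rough_meetUl rough_meet0.

Lemma RS_addE a b : (a + b)%R = rough_join a b. Proof. by []. Qed.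
Lemma RS_mulE a b : (a * b)%R = rough_meet a b. Proof. by []. Qed.

End RoughSemiring.

Definition is_least (disp : Order.disp_t) (T : porderType disp)
    (S : T -> Prop) (m : T) : Prop :=
  S m /\ forall v : T, S v -> (m <= v)%O.

(* [is_dual_rpc y z w]: w is a dual relative pseudocomplement of y with respect
   to z. *)
Definition is_dual_rpc (U : finType) (R : equiv_rel U) (y z w : rough R) : Prop :=
  is_least (fun v : rough R => (y <= (z + v)%R)%O) w.

(* Main.v *)
Require Import Defs.
From HB Require Import structures.
From mathcomp Require Import all_boot all_order all_algebra.

(** T is a finite distributive lattice, so the set of all v with z + v >= y
   contains the top element and is closed under meets; the meet of all its
   elements is therefore its least element. *)

Set Implicit Arguments.
Unset Strict Implicit.
Unset Printing Implicit Defensive.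

Import Order.TTheory GRing.Theory.

(** In [rough R] the product is the meet and the sum is the join. By [rough_addMr] the condition
    [y <= z + v] survives finite products of such [v] ([rough_le_prod]), while a product lies below
    each of its factors ([rough_prod_le]). Antisymmetry gives uniqueness. *)

Section RoughLattice.
Variables (U : finType) (R : equiv_rel U).
Implicit Types a b c : rough R.
Local Open Scope ring_scope.

Lemma rough_leE a b :
  (a <= b)%O = ((approx a).1 \subset (approx b).1)
            && ((approx a).2 \subset (approx b).2).
Proof. by []. Qed.

Lemma rough_leM a b c : (a <= b * c)%O = (a <= b)%O && (a <= c)%O.
Proof. by rewrite !rough_leE RS_mulE approx_meet /= !subsetI andbACA. Qed.

(** This is the dual of the semiring's distributive law; it holds because union distributes over
    intersection in both approximations. *)
Lemma rough_addMr a b c : a + b * c = (a + b) * (a + c).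
Proof.
apply: approx_inj; rewrite !(RS_addE, RS_mulE).
by rewrite !(approx_join, approx_meet) /= !setUIr.
Qed.

Lemma rough_le1 a : (a <= 1)%O.
Proof.
(* Reads [a <= a] as [a <= 1 * a], a bound by a meet. *)
by have := lexx a; rewrite -{2}(mul1r a) rough_leM => /andP[].
Qed.

Lemma rough_leDr a b : (a <= b + a)%O.
Proof. by rewrite rough_leE RS_addE approx_join /= !subsetUr. Qed.

Lemma rough_prod_le (P : pred (rough R)) a : P a -> (\prod_(b | P b) b <= a)%O.
Proof.
by move=> Pa; have := lexx (\prod_(b | P b) b);
  rewrite {2}(bigD1 a) //= rough_leM => /andP[].
Qed.

Lemma rough_le_prod (P : pred (rough R)) a c :
  (forall b, P b -> (a <= c + b)%O) -> (a <= c + \prod_(b | P b) b)%O.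
Proof.
move=> aP; elim/big_ind: _ => // [|b d ab ad].
  (* The empty product is [1], the top element, and [1 <= c + 1]. *)
  exact: le_trans (rough_le1 _) (rough_leDr _ _).
by rewrite rough_addMr rough_leM ab.
Qed.

End RoughLattice.

Theorem theorem7 (U : finType) (U_nonempty : 0 < #|U|) (R : equiv_rel U)
    (y z : rough R) :
  exists! w : rough R, is_dual_rpc y z w.
Proof.
have [w [yw minw]] : exists w : rough R, is_dual_rpc y z w.
  exists (\prod_(v : rough R | (y <= (z + v)%R)%O) v)%R.
  by split=> [|v yv]; [exact: rough_le_prod | exact: rough_prod_le].
exists w; split=> // v [yv minv].
by apply/le_anti; rewrite minw ?minv.
Qed.
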